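(* There is an absolute constant $C$ such that the following holds. Let $q\geq C$ be a prime power and $E \subset \mathbb{F}_q^2$ with $|E| \geq 64 q \log_2 q$. Then pairs of distinct points of $E$ generate at least $\frac{q^2}{8}$ distinct straight lines in $\mathbb{F}_q^2$. Moreover, there exist a point $z\in E$ and at least $\frac{q}{4}$ straight lines incident to $z$, each of which contains at least $\frac{1}{2}\frac{|E|}{q}$ and fewer than $2\frac{|E|}{q}$ points of $E$ other than $z$.
   Context: A straight line in $\mathbb{F}_q^2$ is a set of the form $\{a+sb: s\in\mathbb{F}_q\}$ with $a\in\mathbb{F}_q^2$, $b\in\mathbb{F}_q^2\setminus\{0\}$. A line is generated by a pair of distinct points if it contains both. *)

(* Defs.v *)
From HB Require Import structures.
From mathcomp Require Import all_boot all_order all_algebra.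
From mathcomp Require Import reals exp.

Set Implicit Arguments.
Unset Strict Implicit.
Unset Printing Implicit Defensive.

Import Order.TTheory GRing.Theory Num.Theory.

Local Open Scope ring_scope.

Definition log2 (R : realType) (x : R) : R := ln x / ln 2.

Section Lines.
Variable F : finFieldType.
Implicit Types (a b z : 'rV[F]_2) (L E : {set 'rV[F]_2}).

Definition line a b : {set 'rV[F]_2} := [set a + s *: b | s : F].

Definition is_line L : bool :=
  [exists a, exists b, (b != 0) && (L == line a b)].

(* Lines are point sets, so counting this set counts distinct lines, however
   many pairs of points of E generate the same one. *)
Definition generated_lines E : {set {set 'rV[F]_2}} :=
  [set L | is_line L &&
    [exists x in E, exists y in E, [&& x != y, x \in L & y \in L]]].

End Lines.

(* Main.v *)
(* With m = |E| / q, the numbers i(L) of points of E on the q^2 + q lines L have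
   mean close to m and, since two points span exactly one line,
   sum_L (i(L) - m)^2 <= |E| q.
   As m >= 64, a Chebyshev argument bounds both the number of lines with at most
   one point of E and the number of incidences (z, L) on lines L violating
   m / 2 <= i(L) - 1 < 2 m.  Pigeonholing the remaining incidences over E gives
   the point z. *)
Require Import Defs.
From HB Require Import structures.
From mathcomp Require Import all_boot all_order all_algebra.
From mathcomp Require Import reals exp.
From mathcomp Require Import ring lra zify.

Set Implicit Arguments.
Unset Strict Implicit.
Unset Printing Implicit Defensive.

Import Order.TTheory GRing.Theory Num.Theory.

Local Open Scope ring_scope.


(** Both sides count the pairs (x, L) with x in E, L in Ls and x on L. *)
Lemma double_count (T : finType) (Ls : {set {set T}}) (E : {set T}) :
  (\sum_(L in Ls) #|E :&: L| = \sum_(x in E) #|[set L in Ls | x \in L]|)%N.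
Proof.
have -> : (\sum_(L in Ls) #|E :&: L| = \sum_(L in Ls) \sum_(x in E) (x \in L))%N.
  apply: eq_bigr => L _; rewrite -sum1_card big_mkcond [RHS]big_mkcond /=.
  by apply: eq_bigr => x _; rewrite inE; case: (x \in E); case: (x \in L).
rewrite exchange_big /=; apply: eq_bigr => x _.
rewrite -sum1_card big_mkcond [RHS]big_mkcond /=.
by apply: eq_bigr => L _; rewrite inE; case: (L \in Ls); case: (x \in L).
Qed.

(** * Lines, pencils and incidence counts in the plane over F *)

Section Incidences.
Variable F : finFieldType.
Implicit Types (x y z : 'rV[F]_2) (L E : {set 'rV[F]_2}).

Local Notation q := #|F|.

Definition lines : {set {set 'rV[F]_2}} := [set L | is_line L].
Definition pencil x : {set {set 'rV[F]_2}} := [set L in lines | x \in L].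

Lemma is_lineP L :
  reflect (exists a b, b != 0 /\ L = line a b) (is_line L).
Proof.
apply: (iffP existsP) => [[a /existsP[b /andP[b0 /eqP->]]]|[a [b [b0 ->]]]].
  by exists a, b.
by exists a; apply/existsP; exists b; rewrite b0 eqxx.
Qed.

Lemma card_line L : is_line L -> #|L| = q.
Proof.
case/is_lineP=> a [b [b0 ->]]; rewrite card_imset // => s t /addrI /eqP.
by rewrite -subr_eq0 -scalerBl scaler_eq0 (negPf b0) orbF subr_eq0 => /eqP.
Qed.

(** The difference y - x is a nonzero multiple of the direction b, so an affine change of parameter
    turns one parametrization into the other. *)
Lemma line_through L x y :
  is_line L -> x != y -> x \in L -> y \in L -> L = line x (y - x).
Proof.
move=> /is_lineP[a [b [b0 ->]]] xy /imsetP[s _ xE] /imsetP[t _ yE].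
have st : t - s != 0.
  by apply: contra xy; rewrite subr_eq0 => /eqP ts; rewrite xE yE ts.
have -> : y - x = (t - s) *: b.
  by rewrite xE yE scalerBl opprD addrACA subrr add0r.
apply/setP => w; apply/imsetP/imsetP => -[u _ ->].
  exists ((u - s) / (t - s)) => //.
  by rewrite xE scalerA divfK // -addrA -scalerDl addrCA subrr addr0.
by exists (s + u * (t - s)) => //; rewrite xE scalerA scalerDl addrA.
Qed.

Lemma card_pencilI x y : x != y -> #|[set L in pencil x | y \in L]| = 1%N.
Proof.
move=> xy; apply/eqP/cards1P; exists (line x (y - x)); apply/setP => L.
rewrite !inE; apply/andP/eqP => [[/andP[Ll xL] yL]|->].
  exact: line_through.
split; last by apply/imsetP; exists 1; rewrite // scale1r addrC subrK.
apply/andP; split; last by apply/imsetP; exists 0; rewrite // scale0r addr0.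
by apply/is_lineP; exists x, (y - x); rewrite subr_eq0 eq_sym.
Qed.

(** The point x lies on every line of its pencil, each other point of E on exactly one. *)
Lemma sum_pencil E x : x \in E ->
  (\sum_(L in pencil x) #|E :&: L| = #|pencil x| + #|E|.-1)%N.
Proof.
move=> xE; rewrite double_count (big_setD1 x) //=; congr (_ + _)%N.
  by apply: eq_card => L; rewrite !inE -andbA andbb.
rewrite (eq_bigr (fun=> 1%N)) => [|y]; last first.
  by rewrite !inE => /andP[yx _]; rewrite card_pencilI // eq_sym.
by rewrite sum1_card [in RHS](cardsD1 x) xE.
Qed.

Lemma card_plane : #|[set: 'rV[F]_2]| = (q ^ 2)%N.
Proof. by rewrite cardsT card_mx. Qed.

(** Taking E to be the whole plane in [sum_pencil], a pencil of r lines satisfies r q = r + q^2 - 1;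
    cancel q - 1. *)
Lemma card_pencil x : #|pencil x| = q.+1.
Proof.
have := sum_pencil (in_setT x); rewrite card_plane.
under eq_bigr => L do rewrite setTI.
rewrite (eq_bigr (fun=> q)) => [|L]; last by rewrite !inE => /andP[/card_line].
have := card_finNzRing_gt1 F; rewrite sum_nat_const -mulnn.
case: #|F| => [//|p]; rewrite ltnS => p0 eq_r.
by apply/eqP; rewrite -(eqn_pmul2r p0); apply/eqP; nia.
Qed.

Lemma card_lines : #|lines| = (q * q.+1)%N.
Proof.
have := double_count lines [set: 'rV[F]_2].
under eq_bigr => L do rewrite setTI.
rewrite (eq_bigr (fun=> q)) => [|L]; last by rewrite inE => /card_line.
rewrite [in RHS](eq_bigr (fun=> q.+1)) => [|x _]; last exact: card_pencil.
rewrite !sum_nat_const card_plane.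
by move=> /eqP; rewrite -mulnn mulnAC eqn_pmul2r ?(ltnW (card_finNzRing_gt1 F)) // => /eqP.
Qed.

Lemma sum_incidences E : (\sum_(L in lines) #|E :&: L| = #|E| * q.+1)%N.
Proof.
by rewrite double_count -sum_nat_const; apply: eq_bigr => x _; exact: card_pencil.
Qed.

(** One factor of the square is spent on summing over the points x of E on L; after exchanging sums,
    each x contributes (q + 1) + (|E| - 1). *)
Lemma sum_incidences_sqr E :
  (\sum_(L in lines) #|E :&: L| ^ 2 = #|E| * (q + #|E|))%N.
Proof.
transitivity (\sum_(x in E) \sum_(L in pencil x) #|E :&: L|)%N; last first.
  rewrite -sum_nat_const; apply: eq_bigr => x xE.
  rewrite sum_pencil // card_pencil addSnnS prednK //.
  by apply/card_gt0P; exists x.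
rewrite [RHS](exchange_big_dep (mem lines)) /= => [|x L _]; last first.
  by rewrite !inE => /andP[].
apply: eq_bigr => L lL; rewrite sum_nat_const -mulnn.
congr (_ * _)%N; apply: eq_card => x.
by rewrite [LHS]inE [RHS]unfold_in /= [L \in _]inE lL.
Qed.

(** * Second moment and its consequences *)

Section Chebyshev.
Variables (R : realFieldType) (E : {set 'rV[F]_2}).
Local Notation m := (#|E|%:R / q%:R : R).

Lemma sum_deviation_le :
  \sum_(L in lines) (#|E :&: L|%:R - m) ^+ 2 <= #|E|%:R * q%:R.
Proof.
have q0 : 0 < q%:R :> R by rewrite ltr0n ltnW // card_finNzRing_gt1.
have -> : \sum_(L in lines) (#|E :&: L|%:R - m) ^+ 2 =
    \sum_(L in lines) (#|E :&: L| ^ 2)%:R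
    - 2 * m * \sum_(L in lines) #|E :&: L|%:R + \sum_(L in lines) m ^+ 2.
  rewrite mulr_sumr -sumrB -big_split; apply: eq_bigr => L _ /=.
  by rewrite natrX; ring.
rewrite -!natr_sum sum_incidences sum_incidences_sqr sumr_const card_lines.
rewrite -(mulr_natr (m ^+ 2)) !natrM natrD -[#|F|.+1%:R]natr1.
(* Here m is exactly the mean over the q (q + 1) lines, so this is the variance identity. *)
have -> : #|E|%:R * (q%:R + #|E|%:R) - 2 * m * (#|E|%:R * (q%:R + 1))
    + m ^+ 2 * (q%:R * (q%:R + 1)) = #|E|%:R * q%:R - #|E|%:R ^+ 2 / q%:R.
  by field; rewrite gt_eqF.
by rewrite gerBl divr_ge0 ?sqr_ge0 ?ltW.
Qed.

(** The weight f lets one bound serve twice: f = 1 counts lines, f = |E :&: L| counts incidences.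
    The factor m cancels because |E| q = m q^2. *)
Lemma chebyshev (P : pred {set 'rV[F]_2}) (f : {set 'rV[F]_2} -> R) (c : R) :
  0 < m -> 0 <= c ->
  (forall L, P L -> m * f L <= c * (#|E :&: L|%:R - m) ^+ 2) ->
  \sum_(L in lines | P L) f L <= c * q%:R ^+ 2.
Proof.
move=> m0 c0 Pf; rewrite -(ler_pM2l m0) mulr_sumr.
have q0 : q%:R != 0 :> R by rewrite pnatr_eq0 -lt0n ltnW // card_finNzRing_gt1.
have -> : m * (c * q%:R ^+ 2) = c * (#|E|%:R * q%:R) by field.
apply: le_trans (ler_wpM2l c0 sum_deviation_le).
apply: le_trans (ler_sum _ (fun L lPL => Pf L (proj2 (andP lPL)))) _.
rewrite -mulr_sumr ler_wpM2l // [leRHS](bigID P) /= lerDl.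
by apply: sumr_ge0 => L _; rewrite sqr_ge0.
Qed.

Hypothesis m64 : 64 <= m.

Let m_gt0 : 0 < m. Proof. exact: lt_le_trans m64. Qed.

Lemma generated_lines_ge : q%:R ^+ 2 / 2 <= #|generated_lines E|%:R :> R.
Proof.
have poor : \sum_(L in lines | (#|E :&: L| < 2)%N) 1 <= 32^-1 * q%:R ^+ 2 :> R.
  apply: chebyshev => [||L /=]; rewrite ?m_gt0 ?invr_ge0 //.
  rewrite ltnS -(ler_nat R) => i1.
  move: m64 i1; move: (m) (#|E :&: L|%:R : R) => M i M64 i1.
  (* The product is (M - i)^2 - (M - 1)^2, which reduces the claim to 32 M <= (M - 1)^2. *)
  have : 0 <= (1 - i) * (2 * M - i - 1) by apply: mulr_ge0; lra.
  by nra.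
have rich : \sum_(L in lines | ~~ (#|E :&: L| < 2)%N) 1
    <= #|generated_lines E|%:R :> R.
  rewrite sumr_const ler_nat; apply/subset_leq_card/subsetP => L.
  rewrite unfold_in /= !inE -leqNgt => /andP[-> /card_gt1P[x [y []]]].
  rewrite !inE => /andP[xE xL] /andP[yE yL] xy.
  by apply/exists_inP; exists x => //; apply/exists_inP; exists y; rewrite ?xy ?xL.
have : #|lines|%:R = \sum_(L in lines) 1 :> R by rewrite sumr_const.
rewrite (bigID (fun L => (#|E :&: L| < 2)%N)) /= card_lines natrM -natr1.
have : 0 <= q%:R :> R by [].
by nra.
Qed.

(** The [- 1] discounts the point z of E, on L, that will be chosen later. *)
Definition balanced L : bool :=
  (m / 2 <= #|E :&: L|%:R - 1) && (#|E :&: L|%:R - 1 < 2 * m).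

Lemma exists_balanced_pencil :
  exists2 z, z \in E & q%:R / 4 <= #|[set L in pencil z | balanced L]|%:R :> R.
Proof.
have unbalanced :
    \sum_(L in lines | ~~ balanced L) #|E :&: L|%:R <= 4 * q%:R ^+ 2 :> R.
  apply: chebyshev => [||L]; rewrite ?m_gt0 //.
  rewrite negb_and -ltNge -leNgt.
  have i0 : 0 <= #|E :&: L|%:R :> R by [].
  move: m64 i0; move: (m) (#|E :&: L|%:R : R) => M i M64 i0.
  (* A poor line has i < M / 2 + 1, hence deviation above M / 2 - 1; a rich one has i >= 2 M + 1,
     hence deviation above both M and i / 2. Either way M i <= 4 (i - M)^2. *)
  by case/orP => bad; nra.
have q0 : 0 < q%:R :> R by rewrite ltr0n ltnW // card_finNzRing_gt1.
have Emq : #|E|%:R = m * q%:R by rewrite divfK ?gt_eqF.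
have balancedE : \sum_(L in lines | balanced L) #|E :&: L|%:R =
    \sum_(z in E) #|[set L in pencil z | balanced L]|%:R :> R.
  rewrite -!natr_sum; congr _%:R.
  transitivity (\sum_(L in [set L in lines | balanced L]) #|E :&: L|)%N.
    by apply: eq_bigl => L; rewrite !inE.
  rewrite double_count; apply: eq_bigr => z _; apply: eq_card => L.
  by rewrite !inE andbAC.
have [/exists_inP[z zE zq]|/exists_inPn none] := boolP [exists z in E,
    q%:R / 4 <= #|[set L in pencil z | balanced L]|%:R :> R]; first by exists z.
have few : \sum_(z in E) #|[set L in pencil z | balanced L]|%:R
    <= #|E|%:R * (q%:R / 4) :> R.
  rewrite mulr_natl -sumr_const; apply: ler_sum => z zE.
  by rewrite ltW // ltNge none.
have : (#|E| * q.+1)%:R = \sum_(L in lines) #|E :&: L|%:R :> R.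
  by rewrite -natr_sum sum_incidences.
rewrite (bigID balanced) /= balancedE natrM -natr1 Emq => total.
move: few unbalanced; rewrite Emq => few unbalanced.
(* If no z works, balanced incidences number at most m q^2 / 4 and unbalanced ones at most 4 q^2 <=
   m q^2 / 16, short of the total m q (q + 1). *)
have : 64 * q%:R ^+ 2 <= m * q%:R ^+ 2 by rewrite ler_wpM2r ?sqr_ge0.
have : 0 < m * q%:R by rewrite mulr_gt0.
by nra.
Qed.

End Chebyshev.
End Incidences.

Theorem theorem1p2 :
  exists C : nat,
  forall (R : realType) (q : nat) (F : finFieldType) (E : {set 'rV[F]_2}),
    #|F| = q ->
    (C <= q)%N ->
    64 * q%:R * log2 (q%:R : R) <= #|E|%:R ->
    (q%:R ^+ 2 / 8 <= #|generated_lines E|%:R :> R) /\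
    (exists2 z : 'rV[F]_2, z \in E &
      exists Ls : {set {set 'rV[F]_2}},
        (q%:R / 4 <= #|Ls|%:R :> R) /\
        (forall L : {set 'rV[F]_2}, L \in Ls ->
          [/\ is_line L,
              z \in L,
              1 / 2 * (#|E|%:R / q%:R) <= #|(E :\ z) :&: L|%:R :> R
            & #|(E :\ z) :&: L|%:R < 2 * (#|E|%:R / q%:R) :> R])).
Proof.
(* For q >= 2 the logarithm is at least 1, so the hypothesis on |E| yields m >= 64. *)
exists 2%N => R q F E <- q2 hE.
have q0 : 0 < #|F|%:R :> R by rewrite ltr0n ltnW // card_finNzRing_gt1.
have ln20 : 0 < ln 2 :> R by rewrite ln_gt0 // ltr1n.
have log_ge1 : 1 <= log2 (#|F|%:R : R).
  by rewrite /log2 ler_pdivlMr // mul1r ler_ln ?posrE // ler_nat.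
have m64 : 64 <= #|E|%:R / #|F|%:R :> R.
  rewrite ler_pdivlMr //; apply: le_trans hE.
  by rewrite ler_peMr // mulr_ge0 // ltW.
split.
  apply: le_trans (generated_lines_ge m64).
  by rewrite ler_wpM2l ?sqr_ge0 // lef_pV2 ?posrE // ler_nat.
have [z zE zq] := exists_balanced_pencil m64.
exists z => //; exists [set L in pencil z | balanced R E L]; split=> // L.
rewrite !inE => /andP[/andP[lL zL] /andP[lo hi]].
have iL : #|(E :\ z) :&: L|%:R = #|E :&: L|%:R - 1 :> R.
  rewrite (cardsD1 z (E :&: L)) inE zE zL natrD addrAC subrr add0r.
  by rewrite setIDAC.
by split; rewrite ?iL // mul1r mulrC.
Qed.
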